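(* Let $K\ge1$, $n=K+1$, and let $(M_K^\star,y_0^\star)$ be the extremal instance (defined in the context), with resolvent $L$. Then: (i) Every polynomial $Q$ with $Q(1)=1$ and $\deg Q\le K$ satisfies $$\|(L-I)Q(L)y_0^\star\|\ \ge\ \frac1{K+1}.$$ Hence every method in $\mathcal{A}_\infty$, started at $y_0^\star$ on this instance, satisfies $\|r(y_K)\|\ge\frac1{K+1}$. (ii) Equality in the inequality of (i) holds for exactly one polynomial, namely the one given in the variable $u=2\zeta-1$ by the Fejér polynomial $P^\star(u)=\frac1{K+1}\sum_{i=0}^{K}u^i$, i.e. $Q(\zeta)=P^\star(2\zeta-1)$, so that $Q(L)y_0^\star=\frac1{K+1}\sum_{j=0}^{K}(2L-I)^jy_0^\star$. The instance minimax value (the minimum of $\|(L-I)Q(L)y_0^\star\|$ over all $Q$ with $Q(1)=1$, $\deg Q\le K$) equals $\frac1{K+1}$. (iii) On the same instance, for every $0\le k\le K$ and every polynomial $Q$ with $Q(1)=1$, $\deg Q\le k$, $$\|(L-I)Q(L)y_0^\star\|\ \ge\ \frac1{\sqrt{(K+1)(k+1)}},$$ with equality only for the degree-$k$ Fejér polynomial, i.e. $Q(\zeta)=\frac1{k+1}\sum_{i=0}^{k}(2\zeta-1)^i$.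
   Context: Polynomials have real coefficients and act on the real space $\mathbb{R}^{2n}$. The plane $\mathbb{R}^2$ is identified with $\mathbb{C}$, the matrix $\rho\begin{pmatrix}\cos\theta&-\sin\theta\\ \sin\theta&\cos\theta\end{pmatrix}$ being multiplication by $\rho e^{i\theta}$. Extremal instance: for $K\ge1$ let $n=K+1$, $\phi_j=\frac{(2j+1)\pi}{n}$, $\omega_j=e^{i\phi_j}$ for $j=0,\dots,n-1$ (the $n$ roots of $u^n=-1$), and $w_j=\frac1{n^2}\csc^2\frac{\phi_j}2$. $M_K^\star$ is the skew-adjoint operator on $\mathbb{R}^{2n}=(\mathbb{R}^2)^n$ whose $j$-th $2\times2$ block is multiplication by $-i\tan(\phi_j/2)$, i.e. the matrix $t_j\begin{pmatrix}0&1\\-1&0\end{pmatrix}$ with $t_j=\tan(\phi_j/2)$; by convention a block with $\phi_j=\pi$ (occurring when $n$ is odd) is the normal cone operator of $\{0\}\subset\mathbb{R}^2$, so that the resolvent vanishes on that block. Equivalently, the resolvent $L=(I+M_K^\star)^{-1}$ acts on block $j$ as multiplication by $\zeta_j=\frac{1+\omega_j}2$. The vector $y_0^\star\in\mathbb{R}^{2n}$ has norm $\sqrt{w_j}$ on block $j$; then $\|y_0^\star\|=1$, $0$ is the only zero of $M_K^\star$, and $d_0=\operatorname{dist}(y_0^\star,\{0\})=1$. For an operator with resolvent $J$, $r(y)=J(y)-y$. Class $\mathcal{A}_\infty$: a method which from $y_0$ performs at each iteration $k=0,1,2,\dots$ exactly one resolvent evaluation $x_k=J(v_k)$ at a query point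 $v_k$ in the affine hull of $\{y_0,x_0,\dots,x_{k-1}\}$ and then chooses $y_{k+1}$ in the affine hull of $\{y_0,x_0,\dots,x_k\}$, all (real, sum-one) coefficients being allowed to depend arbitrarily on everything observed so far. *)

(* Defs.v *)
From HB Require Import structures.
From mathcomp Require Import all_boot all_order all_algebra.
From mathcomp Require Import all_classical all_reals all_analysis.

Set Implicit Arguments.
Unset Strict Implicit.
Unset Printing Implicit Defensive.
Import Order.TTheory GRing.Theory Num.Theory.
Local Open Scope classical_set_scope.
Local Open Scope ring_scope.

(* Euclidean (Frobenius) norm; the library norm `|v| on matrices is the
   sup norm. *)
Definition enorm (R : realType) (m p : nat) (v : 'M[R]_(m, p)) : R :=
  Num.sqrt (\sum_i \sum_j v i j ^+ 2).

Definition normal_cone (R : realType) (m : nat) (C : set 'cV[R]_m)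
    (x : 'cV[R]_m) : set 'cV[R]_m :=
  [set g | C x /\ forall z, C z -> (g^T *m (z - x)) 0 0 <= 0].

Section Operators.
Context {R : realType} {V : lmodType R}.

(* The single-valued map (I + M)^-1 of a set-valued operator M: its value at y
   is the x with y \in x + M x (and the default 0 if there is none). *)
Definition resolvent (M : V -> set V) (y : V) : V :=
  xget 0 [set x | M x (y - x)].

Definition residual (J : V -> V) (y : V) : V := J y - y.

(* Q(L) y *)
Definition polyact (Q : {poly R}) (L : V -> V) (y : V) : V :=
  \sum_(i < size Q) Q`_i *: iter i L y.

Definition affine_hull (s : seq V) : set V :=
  [set v | exists2 c : 'I_(size s) -> R,
     \sum_i c i = 1 & v = \sum_i c i *: s`_i].

(* The class A_oo. The argument h of [query] and [update] is the list of
   everything observed so far, y_0 :: x_0 :: x_1 :: ... (past query points and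
   iterates are functions of it), on which the choice of the affine
   coefficients may depend arbitrarily. *)
Record method := Method {
  query : seq V -> V;
  update : seq V -> V;
  query_affine : forall h, h != [::] -> affine_hull h (query h);
  update_affine : forall h, h != [::] -> affine_hull h (update h)
}.

(* [:: y_0; x_0; ...; x_(k-1)] *)
Definition history (m : method) (J : V -> V) (y0 : V) (k : nat) : seq V :=
  iter k (fun h => rcons h (J (query m h))) [:: y0].

(* y_k *)
Definition iterate (m : method) (J : V -> V) (y0 : V) (k : nat) : V :=
  if k is 0 then y0 else update m (history m J y0 k).

End Operators.

Arguments method {R} V.

(* Q(1) = 1 and deg Q <= k *)
Definition admissible (R : realType) (k : nat) : set {poly R} :=
  [set Q | Q.[1] = 1 /\ (size Q <= k.+1)%N].
Arguments admissible {R} k.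

Definition fejer (R : realType) (k : nat) : {poly R} :=
  k.+1%:R^-1 *: \sum_(i < k.+1) 'X^i.

(* The Fejer polynomial of u = 2 zeta - 1, as a polynomial in zeta. *)
Definition fejer_zeta (R : realType) (k : nat) : {poly R} :=
  fejer R k \Po (2%:R *: 'X - 1).

Section ExtremalInstance.
Context (R : realType).

Definition phi (n : nat) (j : 'I_n) : R := (2 * j + 1)%:R * pi / n%:R.

Definition weight (n : nat) (j : 'I_n) : R :=
  (n%:R ^+ 2)^-1 * ((sin (phi j / 2%:R))^-1) ^+ 2.

(* Multiplication by -i on R^2 = C, the matrix ((0, 1), (-1, 0)). *)
Definition mult_minus_i : 'M[R]_2 := delta_mx 0 1 - delta_mx 1 0.

Definition extremal_block (n : nat) (j : 'I_n) (x : 'cV[R]_2) :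
    set 'cV[R]_2 :=
  if phi j == pi then normal_cone [set 0] x
  else [set (tan (phi j / 2%:R) *: mult_minus_i) *m x].

(* (R^2)^n is 'M[R]_(2, n): the j-th block of a point is its j-th column. *)
Definition extremal_op (n : nat) (x : 'M[R]_(2, n)) : set 'M[R]_(2, n) :=
  [set g | forall j, extremal_block j (col j x) (col j g)].

Definition extremal_start (n : nat) (y0 : 'M[R]_(2, n)) : Prop :=
  forall j, enorm (col j y0) = Num.sqrt (weight j).

End ExtremalInstance.

(* Main.v *)
Require Import Defs.
From HB Require Import structures.
From mathcomp Require Import all_boot all_order all_algebra.
From mathcomp Require Import all_classical all_reals all_analysis.
From mathcomp Require Import ring lra.

(* On block j, 2L - 1 is the rotation U by phi_j, and the block of
   z = (L - 1) y_0 has squared norm sin^2(phi_j / 2) w_j = 1 / n^2. As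
   omega_j^n = -1, the sums of cos(d phi_j) over j vanish for 0 < d < n, so
   z, U z, ..., U^(n-1) z are pairwise orthogonal, each of squared norm 1 / n.
   Writing Q(zeta) = P(2 zeta - 1), the squared norm of (L - 1) Q(L) y_0 is thus
   1 / n times the sum of the squared coefficients of P. These sum to
   P(1) = 1, so Cauchy-Schwarz gives the bound, with equality only if they are
   all equal. The iterates of a method are of the form Q(L) y_0. *)

Set Implicit Arguments.
Unset Strict Implicit.
Unset Printing Implicit Defensive.
Import Order.TTheory GRing.Theory Num.Theory.
Local Open Scope classical_set_scope.
Local Open Scope ring_scope.

(** * Polynomials in a linear map, and the reduction of methods to polynomials *)

Section PolyAct.
Context (R : realType) (V : lmodType R).
Implicit Types (P Q : {poly R}) (y : V).

(** Padding with zero coefficients gives polynomials of different sizes a common summation range. *)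
Lemma polyact_wide (L : V -> V) n Q y : (size Q <= n)%N ->
  polyact Q L y = \sum_(i < n) Q`_i *: iter i L y.
Proof.
move=> leQn; rewrite /polyact.
rewrite (big_ord_widen n (fun i => Q`_i *: iter i L y) leQn) big_mkcond /=.
apply: eq_bigr => i _; case: ltnP => // leQi.
by rewrite nth_default ?scale0r.
Qed.

Lemma polyactC (L : V -> V) c y : polyact c%:P L y = c *: y.
Proof. by rewrite (@polyact_wide L 1) ?size_polyC_leq1// big_ord1 coefC. Qed.

Lemma polyactD (L : V -> V) P Q y :
  polyact (P + Q) L y = polyact P L y + polyact Q L y.
Proof.
rewrite !(@polyact_wide L (maxn (size P) (size Q))) ?leq_maxl ?leq_maxr//.
  by rewrite -big_split; apply: eq_bigr => i _; rewrite coefD scalerDl.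
exact: leq_trans (size_polyD _ _) _.
Qed.

Lemma polyactZ (L : V -> V) c Q y : polyact (c *: Q) L y = c *: polyact Q L y.
Proof.
rewrite !(@polyact_wide L (size Q)) ?size_scale_leq// scaler_sumr.
by apply: eq_bigr => i _; rewrite coefZ scalerA.
Qed.

Lemma polyact_sum (L : V -> V) n (c : 'I_n -> R) (Q : 'I_n -> {poly R}) y :
  polyact (\sum_i c i *: Q i) L y = \sum_i c i *: polyact (Q i) L y.
Proof.
apply: (big_ind2 (fun P v => polyact P L y = v)).
- by rewrite -polyC0 polyactC scale0r.
- by move=> P u Q' v <- <-; rewrite polyactD.
- by move=> i _; rewrite polyactZ.
Qed.

Lemma polyactMX (L : V -> V) Q y : polyact (Q * 'X) L y = polyact Q L (L y).
Proof.
rewrite (@polyact_wide L (size Q).+1); last first.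
  by rewrite (leq_trans (size_polyMleq _ _))// size_polyX addn2.
rewrite big_ord_recl coefMX scale0r add0r.
by apply: eq_bigr => i _; rewrite coefMX /= -iterSr.
Qed.

Lemma polyact_is_linear (L : {linear V -> V}) Q a u v :
  polyact Q L (a *: u + v) = a *: polyact Q L u + polyact Q L v.
Proof.
rewrite /polyact scaler_sumr -big_split; apply: eq_bigr => i _ /=.
rewrite scalerA mulrC -scalerA -scalerDr; congr (_ *: _).
by elim: (i : nat) => //= m ->; rewrite linearP.
Qed.

Lemma polyact_comm (L : {linear V -> V}) Q y :
  L (polyact Q L y) = polyact Q L (L y).
Proof.
rewrite /polyact linear_sum; apply: eq_bigr => i _ /=.
by rewrite linearZ -iterS iterSr.
Qed.

(** Changing the variable in the polynomial amounts to changing the operator; the proof follows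
    Horner's scheme. It is what allows passing from [L] to [2L - I]. *)
Lemma polyact_comp_affine (L : {linear V -> V}) P a b y :
  polyact (P \Po (a *: 'X + b%:P)) L y
    = polyact P (fun v => a *: L v + b *: v) y.
Proof.
elim/poly_ind: P y => [|P c IH] y.
  by rewrite comp_poly0 -polyC0 !polyactC !scale0r.
rewrite comp_polyD comp_polyC comp_polyM comp_polyX !polyactD !polyactC.
congr (_ + _); rewrite polyactMX -IH mulrDr -scalerAr.
rewrite -(mulrC b%:P) mul_polyC.
rewrite polyactD !polyactZ polyactMX polyact_is_linear; congr (_ + _).
(* Adding [0] brings [b *: y] to the form [a *: u + v]; the extra term is the action on [0], which
   vanishes. *)
rewrite -[b *: y]addr0 polyact_is_linear.
by rewrite [X in _ = _ + X]/polyact big1 ?addr0// => i _; rewrite iter_fix ?linear0 ?scaler0.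
Qed.

Lemma admissible_le k l Q : (k <= l)%N -> admissible k Q -> admissible l Q.
Proof. by move=> lekl [Q1 sQ]; split=> //; exact: leq_trans sQ _. Qed.

(** Coefficients of sum one preserve the normalization [Q(1) = 1], and linear combinations preserve
    the degree bound. *)
Lemma affine_hull_polyact (L : V -> V) k y (s : seq V) v :
  (forall x, x \in s -> exists2 Q, admissible k Q & x = polyact Q L y) ->
  affine_hull s v -> exists2 Q, admissible k Q & v = polyact Q L y.
Proof.
move=> hs [c sum_c ->].
have /choice[q hq] (i : 'I_(size s)) :
    exists Q, admissible k Q /\ s`_i = polyact Q L y.
  by have [|Q ? ?] := hs s`_i; [exact: mem_nth | exists Q].
exists (\sum_i c i *: q i).
  split.
    rewrite horner_sum -[RHS]sum_c; apply: eq_bigr => i _.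
    by rewrite hornerZ; have [[-> _] _] := hq i; rewrite mulr1.
  apply: (big_ind (fun P => (size P <= k.+1)%N)).
  - by rewrite size_poly0.
  - by move=> P Q sP sQ; rewrite (leq_trans (size_polyD _ _))// geq_max sP.
  - move=> i _; have [[_ sQ] _] := hq i.
    exact: leq_trans (size_scale_leq _ _) sQ.
by rewrite polyact_sum; apply: eq_bigr => i _; have [_ <-] := hq i.
Qed.

(** A resolvent evaluation multiplies the polynomial of the query point by ['X]: the degree grows by
    at most one and the value at 1 is kept. However adaptive the coefficients are, they are just
    numbers along a given run. *)
Lemma history_polyact (L : {linear V -> V}) (m : method V) y k x :
  x \in history m L y k -> exists2 Q, admissible k Q & x = polyact Q L y.
Proof.
elim: k x => [|k IH] x.
  rewrite inE => /eqP ->; exists 1; last by rewrite polyactC scale1r.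
  by split; rewrite ?hornerC ?size_poly1.
rewrite /history iterS -/(history m L y k) mem_rcons inE => /orP[/eqP->|hx].
  have [|Q adQ ->] := affine_hull_polyact IH (@query_affine _ _ m _ _).
    by case: (k) => // l; rewrite /history iterS -size_eq0 size_rcons.
  exists (Q * 'X); last by rewrite polyactMX polyact_comm.
  have [Q1 sQ] := adQ; split; first by rewrite hornerMX Q1 mulr1.
  by rewrite (leq_trans (size_polyMleq _ _))// size_polyX addn2.
by have [Q adQ ->] := IH x hx; exists Q => //; apply: admissible_le adQ.
Qed.

Lemma iterate_polyact (L : {linear V -> V}) (m : method V) y k :
  exists2 Q, admissible k Q & iterate m L y k = polyact Q L y.
Proof.
case: k => [|k].
  exists 1; last by rewrite polyactC scale1r.
  by split; rewrite ?hornerC ?size_poly1.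
apply: (affine_hull_polyact (@history_polyact L m y k.+1)).
by apply: update_affine; rewrite /history iterS -size_eq0 size_rcons.
Qed.

End PolyAct.

(** * The inner product behind [enorm] *)

Section FrobeniusProduct.
Context (R : realType) (m p : nat).
Implicit Types u v : 'M[R]_(m, p).

Definition frob u v : R := \sum_i \sum_j u i j * v i j.

Lemma frobE u v : frob u v = \tr (u *m v^T).
Proof.
apply: eq_bigr => i _; rewrite mxE.
by apply: eq_bigr => j _; rewrite mxE.
Qed.

Lemma frobvv_ge0 v : 0 <= frob v v.
Proof. by apply: sumr_ge0 => i _; apply: sumr_ge0 => j _; rewrite -expr2 sqr_ge0. Qed.

Lemma enormE v : enorm v = Num.sqrt (frob v v).
Proof. by []. Qed.

Lemma enorm_sqr v : enorm v ^+ 2 = frob v v.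
Proof. by rewrite enormE sqr_sqrtr// frobvv_ge0. Qed.

(** Pythagoras for an orthogonal family of common squared norm [g]. *)
Lemma frob_orth_sum d (c : 'I_d -> R) (v : 'I_d -> 'M[R]_(m, p)) g :
  (forall a b, frob (v a) (v b) = (a == b)%:R * g) ->
  frob (\sum_a c a *: v a) (\sum_a c a *: v a) = g * \sum_a c a ^+ 2.
Proof.
move=> hv; rewrite frobE mulmx_suml raddf_sum mulr_sumr; apply: eq_bigr => a _ /=.
rewrite raddf_sum mulmx_sumr raddf_sum /=.
have termE b : \tr (c a *: v a *m (c b *: v b)^T) = c a * c b * ((a == b)%:R * g).
  by rewrite linearZ -scalemxAl -scalemxAr scalerA mxtraceZ -frobE hv.
rewrite (bigD1 a)//= termE eqxx big1 => [|b ba].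
  by rewrite addr0 mul1r mulrC -expr2.
by rewrite termE eq_sym (negPf ba) mul0r mulr0.
Qed.

End FrobeniusProduct.

(** * Orthogonality relations for the angles [phi] *)

Section Cosines.
Context (R : realType).

(* Multiplying by [2 sin (d pi / n)] makes the sum telescope. *)
Lemma sum_cos_phi n d : (0 < d < n)%N ->
  \sum_(j < n) cos (d%:R * phi R j) = 0.
Proof.
move=> /andP[d0 dn].
have n0 : n%:R != 0 :> R by rewrite pnatr_eq0 -lt0n (ltn_trans d0).
set s : R := sin (d%:R * pi / n%:R).
have npos : 0 < n%:R :> R by rewrite ltr0n (ltn_trans d0).
have s0 : s != 0.
  apply: lt0r_neq0; apply: sin_gt0_pi; apply/andP; split.
    by rewrite divr_gt0// mulr_gt0 ?pi_gt0// ltr0n.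
  by rewrite ltr_pdivrMr// mulrC ltr_pM2l ?pi_gt0// ltr_nat.
have sumE : s * 2 * (\sum_(j < n) cos (d%:R * phi R j)) = 0.
  (* The angle [d phi_j] is the midpoint of the angles in [f j] and [f j.+1], so their difference is
     [2 sin (d pi / n) cos (d phi_j)]. *)
  pose f (j : nat) : R := sin (d%:R * (2 * j)%:R * pi / n%:R).
  rewrite mulr_sumr (eq_bigr (fun j : 'I_n => f j.+1 - f j)); last first.
    move=> j _; rewrite /f /s /phi.
    set A := d%:R * ((2 * j + 1)%:R * pi / n%:R).
    have -> : d%:R * (2 * j.+1)%:R * pi / n%:R = A + d%:R * pi / n%:R.
      by rewrite /A mulnS addnC !natrD; field.
    have -> : d%:R * (2 * j)%:R * pi / n%:R = A - d%:R * pi / n%:R.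
      by rewrite /A natrD; field.
    by rewrite sinB sinD; ring.
  (* What survives is [f n - f 0], that is [sin (2 d pi) - sin 0]. *)
  rewrite -(big_mkord xpredT (fun j => f j.+1 - f j)) telescope_sumr//.
  rewrite /f muln0 mulr0 !mul0r sin0 subr0.
  have -> : d%:R * (2 * n)%:R * pi / n%:R = 0 + pi *+ 2 *+ d :> R.
    by rewrite add0r -[pi *+ 2 *+ d]mulr_natl -[pi *+ 2]mulr_natl natrM; field.
  by rewrite (periodicn (@sinD2pi R)) sin0.
move/eqP: sumE; rewrite !mulf_eq0 (negPf s0) pnatr_eq0/=.
by move/eqP.
Qed.

(** Distinct indices differ by some [d] with [0 < d < n]; evenness of the cosine makes the order of
    [a] and [b] irrelevant. *)
Lemma sum_cos_phiB n (a b : 'I_n) :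
  \sum_(j < n) cos (a%:R * phi R j - b%:R * phi R j) = (a == b)%:R * n%:R.
Proof.
wlog leab : a b / (b <= a)%N.
  move=> hw; case: (leqP b a) => [/hw//|/ltnW/hw]; rewrite eq_sym => <-.
  by apply: eq_bigr => j _; rewrite -cosN opprB.
have [->|neab] := eqVneq a b.
  rewrite mul1r (eq_bigr (fun=> 1)) => [|j _]; last by rewrite subrr cos0.
  by rewrite sumr_const card_ord.
rewrite mul0r -[RHS](@sum_cos_phi n (a - b)).
  by apply: eq_bigr => j _; rewrite natrB// mulrBl.
by rewrite subn_gt0 ltn_neqAle eq_sym neab leab (leq_ltn_trans (leq_subr _ _)).
Qed.

End Cosines.


(** * Complex multiplication on a single block *)

Section Rotations.
Context (R : realType).
Implicit Types (a b : R) (v : 'cV[R]_2).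

(* Multiplication by [e^(i a)] on R^2 = C. *)
Definition rotmx a : 'M[R]_2 := (cos a)%:M - sin a *: mult_minus_i R.

Lemma mulmx2E (A : 'M[R]_2) v i : (A *m v) i 0 = A i 0 * v 0 0 + A i 1 * v 1 0.
Proof.
rewrite mxE big_ord_recl big_ord1.
by have -> : lift ord0 ord0 = 1 :> 'I_2 by apply: val_inj.
Qed.

Lemma cV2P (u v : 'cV[R]_2) : u 0 0 = v 0 0 -> u 1 0 = v 1 0 -> u = v.
Proof.
move=> e0 e1; apply/colP => i.
case: (splitP (i : 'I_(1 + 1))) => k; rewrite ord1 => ik.
  by have -> : i = 0 by apply: val_inj.
by have -> : i = 1 by apply: val_inj.
Qed.

Lemma rotmxE0 a v : (rotmx a *m v) 0 0 = cos a * v 0 0 - sin a * v 1 0.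
Proof. by rewrite mulmx2E !mxE /=; ring. Qed.

Lemma rotmxE1 a v : (rotmx a *m v) 1 0 = sin a * v 0 0 + cos a * v 1 0.
Proof. by rewrite mulmx2E !mxE /=; ring. Qed.

Lemma minus_iE0 v : (mult_minus_i R *m v) 0 0 = v 1 0.
Proof. by rewrite mulmx2E !mxE /=; ring. Qed.

Lemma minus_iE1 v : (mult_minus_i R *m v) 1 0 = - v 0 0.
Proof. by rewrite mulmx2E !mxE /=; ring. Qed.

Lemma frob_cV2 (u v : 'cV[R]_2) : frob u v = u 0 0 * v 0 0 + u 1 0 * v 1 0.
Proof.
rewrite /frob big_ord_recl !big_ord1.
by have -> : lift ord0 ord0 = 1 :> 'I_2 by apply: val_inj.
Qed.

Let addmxE m p (A B : 'M[R]_(m, p)) i j : (A + B) i j = A i j + B i j.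
Proof. by rewrite mxE. Qed.

Let oppmxE m p (A : 'M[R]_(m, p)) i j : (- A) i j = - A i j.
Proof. by rewrite mxE. Qed.

Let scalemxE m p c (A : 'M[R]_(m, p)) i j : (c *: A) i j = c * A i j.
Proof. by rewrite mxE. Qed.

Let cV2E := (rotmxE0, rotmxE1, minus_iE0, minus_iE1, addmxE, oppmxE, scalemxE).

Lemma rotmx0 v : rotmx 0 *m v = v.
Proof. by apply: cV2P; rewrite !cV2E cos0 sin0; ring. Qed.

Lemma rotmxD a b v : rotmx a *m (rotmx b *m v) = rotmx (a + b) *m v.
Proof.
by apply: cV2P; rewrite !cV2E cosD sinD; ring.
Qed.

Lemma frob_rotmx a b v :
  frob (rotmx a *m v) (rotmx b *m v) = cos (a - b) * frob v v.
Proof. by rewrite !frob_cV2 !cV2E cosB; ring. Qed.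

(* (1 + e^(2ih)) / 2 = cos h e^(ih) *)
Lemma rotmx_double h v :
  2%:R *: (cos h *: (rotmx h *m v)) - v = rotmx (h *+ 2) *m v.
Proof.
apply: cV2P; rewrite !cV2E cos_mulr2n sin_mulr2n.
  by ring.
by ring.
Qed.

(** As complex numbers, [cos h e^(ih) - 1 = i sin h e^(ih)]. *)
Lemma frob_cos_rotmx_sub h v :
  frob (cos h *: (rotmx h *m v) - v) (cos h *: (rotmx h *m v) - v)
    = sin h ^+ 2 * frob v v.
Proof.
have E : cos h ^+ 2 = 1 - sin h ^+ 2 by rewrite -(cos2Dsin2 h); ring.
rewrite !frob_cV2 !cV2E.
transitivity ((cos h ^+ 2 * (cos h ^+ 2 + sin h ^+ 2 - 2) + 1)
  * (v 0 0 * v 0 0 + v 1 0 * v 1 0)); first by ring.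
by rewrite E; ring.
Qed.

(* The resolvent equation [v - x = - i tan h x] of a block. *)
Lemma tan_block_resolvent h v x : cos h != 0 ->
  (v - x = (tan h *: mult_minus_i R) *m x) <-> x = cos h *: (rotmx h *m v).
Proof.
move=> c0; have E : cos h ^+ 2 = 1 - sin h ^+ 2 by rewrite -(cos2Dsin2 h); ring.
rewrite -scalemxAl; split=> [eqv|->]; last first.
  apply: cV2P; rewrite !cV2E /tan.
    transitivity (v 0 0 * (1 - cos h ^+ 2) + sin h * cos h * v 1 0); first by ring.
    by rewrite E; field.
  transitivity (v 1 0 * (1 - cos h ^+ 2) - sin h * cos h * v 0 0); first by ring.
  by rewrite E; field.
have -> : v = tan h *: (mult_minus_i R *m x) + x by rewrite -eqv subrK.
apply: cV2P; rewrite !cV2E /tan.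
  transitivity (x 0 0 * (cos h ^+ 2 + sin h ^+ 2)); last by field.
  by rewrite cos2Dsin2 mulr1.
transitivity (x 1 0 * (cos h ^+ 2 + sin h ^+ 2)); last by field.
by rewrite cos2Dsin2 mulr1.
Qed.

(** The cone is everything at [0] and empty elsewhere. *)
Lemma normal_cone0 m (x g : 'cV[R]_m) : normal_cone [set 0] x g <-> x = 0.
Proof.
split=> [[]//|->]; split=> // z ->.
by rewrite subrr mulmx0 mxE.
Qed.

End Rotations.

(** * Block-diagonal linear maps *)

Section BlockMap.
Context (R : realType) (n : nat).
Implicit Types (A : 'I_n -> 'M[R]_2) (y : 'M[R]_(2, n)).

Definition blockmap A y : 'M[R]_(2, n) := \matrix_(i, j) (A j *m col j y) i 0.

Lemma col_blockmap A y j : col j (blockmap A y) = A j *m col j y.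
Proof. by apply/colP => i; rewrite !mxE. Qed.

Lemma mx_colP m (y z : 'M[R]_(m, n)) : (forall j, col j y = col j z) -> y = z.
Proof.
by move=> yz; apply/matrixP => i j; have /colP/(_ i) := yz j; rewrite !mxE.
Qed.

(** Registered as an instance below because the polynomial calculus requires a [{linear V -> V}],
    which [resolvent] becomes only once rewritten as a [blockmap]. *)
Fact blockmap_is_linear A : linear (blockmap A).
Proof.
move=> c u v; apply: mx_colP => j.
by rewrite col_blockmap !linearP /= !col_blockmap.
Qed.
HB.instance Definition _ A :=
  GRing.isLinear.Build R 'M[R]_(2, n) 'M[R]_(2, n) _ (blockmap A)
    (blockmap_is_linear A).

Lemma frob_col m (u v : 'M[R]_(m, n)) :
  frob u v = \sum_j frob (col j u) (col j v).
Proof.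
rewrite /frob exchange_big; apply: eq_bigr => j _; apply: eq_bigr => i _.
by rewrite big_ord1 !mxE.
Qed.

Lemma col_iter_rotation (theta : 'I_n -> R) a y j :
  col j (iter a (blockmap (fun j => rotmx (theta j))) y)
    = rotmx (a%:R * theta j) *m col j y.
Proof.
elim: a => [|a IH]; first by rewrite mul0r rotmx0.
by rewrite iterS col_blockmap IH rotmxD mulrSr mulrDl mul1r addrC.
Qed.

End BlockMap.

(** * The resolvent of the extremal operator in closed form *)

Section ExtremalResolvent.
Context (R : realType) (n : nat).
Implicit Types (y : 'M[R]_(2, n)).

Definition half_phi (j : 'I_n) : R := phi R j / 2%:R.

Lemma phi_halfE j : phi R j = half_phi j *+ 2.
Proof. by rewrite /half_phi -mulr_natr; field. Qed.

Lemma half_phi_bounds j : 0 < half_phi j < pi.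
Proof.
have n0 : 0 < n%:R :> R by rewrite ltr0n (leq_ltn_trans _ (ltn_ord j)).
rewrite /half_phi /phi; apply/andP; split.
  by rewrite !divr_gt0// mulr_gt0 ?pi_gt0// ltr0n addn1.
rewrite !ltr_pdivrMr// mulrC -mulrA ltr_pM2l ?pi_gt0//.
by rewrite -natrM ltr_nat addn1 !mul2n ltn_Sdouble.
Qed.

(** The exceptional block is exactly the one where the tangent has its pole; the cosine is injective
    on [[0, pi]]. *)
Lemma cos_half_phi_eq0 j : (cos (half_phi j) == 0) = (phi R j == pi).
Proof.
have /andP[h0 hpi] := half_phi_bounds j.
have -> : (phi R j == pi) = (half_phi j == pi / 2%:R).
  by rewrite /half_phi (inj_eq (mulIf _))// invr_eq0.
have pi0 := pi_gt0 R.
apply/eqP/eqP => [ch|->]; last exact: cos_pihalf.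
apply: cos_inj; rewrite ?in_itv/= ?ch ?cos_pihalf// ?(ltW h0) ?(ltW hpi)//.
by apply/andP; split; lra.
Qed.

(** One formula covers both kinds of block: [(1 + omega_j) / 2] vanishes at [phi_j = pi], in
    agreement with the normal cone convention. *)
Lemma extremal_blockE (j : 'I_n) (v x : 'cV[R]_2) :
  extremal_block j x (v - x) <-> x = cos (half_phi j) *: (rotmx (half_phi j) *m v).
Proof.
rewrite /extremal_block -cos_half_phi_eq0; case: eqVneq => [->|c0].
  by rewrite scale0r; exact: normal_cone0.
exact: (tan_block_resolvent v x c0).
Qed.

Lemma resolvent_extremal :
  resolvent (@extremal_op R n)
    = blockmap (fun j => cos (half_phi j) *: rotmx (half_phi j)).
Proof.
(* Existence and uniqueness hold block by block, so the default value of [xget] never occurs. *)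
apply/funext => y; apply: xget_unique => [j|x hx].
  rewrite raddfB /=; apply/extremal_blockE.
  by rewrite col_blockmap scalemxAl.
apply: mx_colP => j; rewrite col_blockmap -scalemxAl.
by apply/extremal_blockE; have := hx j; rewrite raddfB.
Qed.

Lemma two_resolvent_sub1 :
  (fun y => 2%:R *: resolvent (@extremal_op R n) y + (-1) *: y)
    = blockmap (fun j => rotmx (phi R j)).
Proof.
rewrite resolvent_extremal; apply/funext => y; apply: mx_colP => j.
rewrite scaleN1r raddfB /= linearZ /= !col_blockmap -scalemxAl.
by rewrite rotmx_double phi_halfE.
Qed.

(** The cosecant in the weight cancels the factor [sin^2 (phi_j / 2)] produced by [L - I], so all
    blocks count equally. *)
Lemma frob_col_residual y j : extremal_start y ->
  frob (col j (residual (resolvent (@extremal_op R n)) y))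
       (col j (residual (resolvent (@extremal_op R n)) y)) = n%:R ^- 2.
Proof.
move=> /(_ j) hy; have /sin_gt0_pi s0 := half_phi_bounds j.
have w0 : 0 <= weight R j by rewrite mulr_ge0 ?invr_ge0 ?sqr_ge0.
rewrite resolvent_extremal /residual raddfB /= col_blockmap -scalemxAl.
rewrite frob_cos_rotmx_sub -enorm_sqr hy sqr_sqrtr// /weight -/(half_phi j).
by rewrite mulrCA -exprMn divff ?gt_eqF// expr1n mulr1.
Qed.

End ExtremalResolvent.

(** * The variable [u = 2 zeta - 1] and the coefficient problem *)

Section FejerExtremality.
Context (R : realType).
Implicit Types (P Q : {poly R}).

(** The substitution [zeta = (u + 1) / 2]. It fixes 1 and does not raise the degree, hence preserves
    admissibility, as does its inverse [to_zeta]. *)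
Definition to_u Q := Q \Po (2%:R^-1 *: 'X + 2%:R^-1%:P).

Definition to_zeta P := P \Po (2%:R *: 'X + (-1)%:P).

Lemma to_uK : cancel to_u to_zeta.
Proof.
move=> Q; rewrite /to_zeta /to_u -comp_polyA comp_polyD comp_polyZ comp_polyX.
rewrite comp_polyC scalerDr scalerA mulVf ?pnatr_eq0// scale1r -addrA.
by rewrite -mul_polyC -polyCM -polyCD mulrN1 addNr addr0 comp_polyXr.
Qed.

Lemma to_zetaK : cancel to_zeta to_u.
Proof.
move=> P; rewrite /to_zeta /to_u -comp_polyA comp_polyD comp_polyZ comp_polyX.
rewrite comp_polyC scalerDr scalerA divff ?pnatr_eq0// scale1r -addrA.
by rewrite -mul_polyC -polyCM -polyCD divff ?pnatr_eq0// subrr addr0 comp_polyXr.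
Qed.

Lemma size_comp_affine P (a b : R) k :
  (size P <= k.+1)%N -> (size (P \Po (a *: 'X + b%:P)) <= k.+1)%N.
Proof.
move=> sP; apply: leq_trans (size_comp_poly_leq _ _) _; rewrite ltnS.
have s2 : (size (a *: 'X + b%:P)%R <= 2)%N.
  rewrite (leq_trans (size_polyD _ _))// geq_max.
  rewrite (leq_trans (size_scale_leq _ _)) ?size_polyX//.
  exact: leq_trans (size_polyC_leq1 _) _.
apply: leq_trans (_ : (size P).-1 * 1 <= _)%N.
  by rewrite leq_mul2l -[1%N]/2.-1 -!subn1 leq_sub2r ?orbT.
by rewrite muln1 -subn1 leq_subLR.
Qed.

Lemma admissible_to_u k Q : admissible k Q -> admissible k (to_u Q).
Proof.
move=> [Q1 sQ]; split; last exact: size_comp_affine.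
by rewrite horner_comp !hornerE -[X in Q.[X]](_ : 1 = _) //; field.
Qed.

Lemma admissible_to_zeta k P : admissible k P -> admissible k (to_zeta P).
Proof.
move=> [P1 sP]; split; last exact: size_comp_affine.
by rewrite horner_comp !hornerE -[X in P.[X]](_ : 1 = _) //; ring.
Qed.

Lemma fejer_zetaE k : fejer_zeta R k = to_zeta (fejer R k).
Proof. by rewrite /fejer_zeta /to_zeta polyCN. Qed.

Lemma fejerE k : fejer R k = \poly_(i < k.+1) k.+1%:R^-1.
Proof.
by rewrite /fejer poly_def scaler_sumr.
Qed.

Lemma admissible_fejer k : admissible k (fejer R k).
Proof.
rewrite fejerE; split; last exact: size_poly.
rewrite (horner_coef_wide _ (size_poly _ _)).
rewrite (eq_bigr (fun=> k.+1%:R^-1)) => [|i _].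
  by rewrite sumr_const card_ord -[LHS]mulr_natl divff ?pnatr_eq0.
by rewrite coef_poly ltn_ord expr1n mulr1.
Qed.

(* Cauchy-Schwarz against the constant sequence, in the form of an identity:
   the deviation from the mean measures the excess. *)
Lemma sum_sqr_coef k P : admissible k P ->
  \sum_(a < k.+1) P`_a ^+ 2
    = k.+1%:R^-1 + \sum_(a < k.+1) (P`_a - k.+1%:R^-1) ^+ 2.
Proof.
move=> [P1 sP]; set c := k.+1%:R^-1.
have sumP : \sum_(a < k.+1) P`_a = 1.
  rewrite -P1 (horner_coef_wide _ sP).
  by apply: eq_bigr => a _; rewrite expr1n mulr1.
rewrite [X in _ = _ + X](eq_bigr (fun a : 'I_k.+1 =>
  P`_a ^+ 2 + (c ^+ 2 - 2%:R * c * P`_a))) => [|a _]; last by ring.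
have sumcP : \sum_(a < k.+1) 2%:R * c * P`_a = 2%:R * c.
  by rewrite -mulr_sumr sumP mulr1.
rewrite !big_split /= sumrN sumcP sumr_const card_ord -[_ *+ k.+1]mulr_natl.
have -> : k.+1%:R * c ^+ 2 = c by rewrite /c expr2 mulVKf ?pnatr_eq0.
by ring.
Qed.

End FejerExtremality.

(** * The residual norm as a function of the coefficients *)

Section ExtremalResidual.
Context (R : realType) (n : nat) (y : 'M[R]_(2, n)).
Hypothesis hy : extremal_start y.

Let L := resolvent (@extremal_op R n).
Let U := blockmap (fun j : 'I_n => rotmx (phi R j)).

Lemma polyact_resolvent Q v : polyact Q L v = polyact (to_u Q) U v.
Proof.
rewrite -{1}[Q]to_uK /to_zeta /L resolvent_extremal polyact_comp_affine.
by rewrite /= -resolvent_extremal two_resolvent_sub1.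
Qed.

Lemma frob_residual_orth a b :
  (a < n)%N -> (b < n)%N ->
  frob (residual L (iter a U y)) (residual L (iter b U y))
    = (a == b)%:R * n%:R^-1.
Proof.
move=> an bn.
(* Multiplications by complex numbers commute, so [L - I] can be applied before the rotations. *)
have colE c j : col j (residual L (iter c U y))
    = rotmx (c%:R * phi R j) *m col j (residual L y).
  rewrite /residual /L resolvent_extremal !raddfB /= !col_blockmap.
  rewrite col_iter_rotation -!scalemxAl -scalemxAr !rotmxD.
  by rewrite [half_phi R j + _]addrC.
rewrite frob_col.
rewrite (eq_bigr (fun j => n%:R ^- 2 * cos (a%:R * phi R j - b%:R * phi R j))).
  have n0 : n%:R != 0 :> R by rewrite pnatr_eq0 -lt0n (leq_ltn_trans _ an).
  rewrite -mulr_sumr (sum_cos_phiB R (Ordinal an) (Ordinal bn)) mulrCA.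
  by congr (_ * _); field.
by move=> j _; rewrite !colE frob_rotmx frob_col_residual// mulrC.
Qed.

(** An exact formula, from which both the bound and its equality case are read off: the last sum is
    the excess over the minimum. *)
Lemma enorm_residual_sqr k Q : (k < n)%N -> admissible k Q ->
  enorm (residual L (polyact Q L y)) ^+ 2
    = (n%:R * k.+1%:R)^-1
      + n%:R^-1 * \sum_(a < k.+1) ((to_u Q)`_a - k.+1%:R^-1) ^+ 2.
Proof.
move=> kn /admissible_to_u adP; have [_ sP] := adP.
rewrite invfM -mulrDr -(sum_sqr_coef adP) enorm_sqr polyact_resolvent.
rewrite (polyact_wide _ _ sP).
have -> : residual L (\sum_(a < k.+1) (to_u Q)`_a *: iter a U y)
    = \sum_(a < k.+1) (to_u Q)`_a *: residual L (iter a U y).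
  rewrite /residual /L resolvent_extremal linear_sum -sumrB.
  by apply: eq_bigr => a _; rewrite linearZ scalerBr.
apply: frob_orth_sum => a b; apply: frob_residual_orth;
  exact: leq_trans (ltn_ord _) kn.
Qed.

Lemma enorm_residual_ge k Q : (k < n)%N -> admissible k Q ->
  1 / Num.sqrt (n%:R * k.+1%:R) <= enorm (residual L (polyact Q L y)).
Proof.
move=> kn adQ; rewrite div1r -sqrtrV ?mulr_ge0 ?ler0n//.
rewrite -[leRHS]ger0_norm ?sqrtr_ge0// -sqrtr_sqr ler_wsqrtr//.
rewrite (enorm_residual_sqr kn adQ) lerDl mulr_ge0 ?invr_ge0//.
by apply: sumr_ge0 => a _; exact: sqr_ge0.
Qed.

Lemma enorm_residual_minimizer k : (k < n)%N ->
  [set Q : {poly R} | admissible k Q /\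
      enorm (residual L (polyact Q L y)) = 1 / Num.sqrt (n%:R * k.+1%:R)]
    = [set fejer_zeta R k].
Proof.
move=> kn; have n0 : 0 < n%:R :> R by rewrite ltr0n (leq_ltn_trans _ kn).
have c0 : 0 <= (n%:R * k.+1%:R)^-1 :> R by rewrite invr_ge0 mulr_ge0 ?ler0n.
rewrite div1r -sqrtrV ?mulr_ge0 ?ler0n// fejer_zetaE.
apply/seteqP; split=> [Q [adQ eqQ]|_ ->] /=.
  have [_ sP] := admissible_to_u adQ.
  have /eqP := enorm_residual_sqr kn adQ.
  rewrite eqQ sqr_sqrtr// -[X in X == _]addr0 (inj_eq (addrI _)) eq_sym
    mulf_eq0 invr_eq0 gt_eqF//=.
  (* A vanishing sum of squares makes every coefficient up to degree [k] equal to [1 / (k + 1)];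
     higher ones vanish by the degree bound. *)
  rewrite psumr_eq0 => [/allP dev0|a _]; last exact: sqr_ge0.
  apply: (can_inj (@to_uK R)); rewrite to_zetaK fejerE.
  apply/polyP => i; rewrite coef_poly; case: ltnP => [ik|ki]; last first.
    by rewrite nth_default// (leq_trans sP).
  have := dev0 (Ordinal ik) (mem_index_enum _).
  by rewrite /= sqrf_eq0 subr_eq0 => /eqP.
have adF := admissible_to_zeta (admissible_fejer R k); split=> //.
rewrite -[LHS]ger0_norm ?sqrtr_ge0// -sqrtr_sqr; congr Num.sqrt.
rewrite (enorm_residual_sqr kn adF) to_zetaK big1 ?mulr0 ?addr0// => a _.
by rewrite fejerE coef_poly ltn_ord subrr expr0n.
Qed.

End ExtremalResidual.

Theorem theorem4p4 (R : realType) (K : nat) (hK : (1 <= K)%N)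
    (y0 : 'M[R]_(2, K.+1)) (hy0 : extremal_start y0) :
  let L : 'M[R]_(2, K.+1) -> 'M[R]_(2, K.+1) :=
    resolvent (@extremal_op R K.+1) in
  (* (i) *)
  ((forall Q : {poly R}, admissible K Q ->
      1 / K.+1%:R <= enorm (residual L (polyact Q L y0))) /\
   (forall m : method 'M[R]_(2, K.+1),
      1 / K.+1%:R <= enorm (residual L (iterate m L y0 K)))) /\
  (* (ii) *)
  ([set Q : {poly R} | admissible K Q /\
      enorm (residual L (polyact Q L y0)) = 1 / K.+1%:R]
     = [set fejer_zeta R K] /\
   polyact (fejer_zeta R K) L y0
     = (1 / K.+1%:R) *: \sum_(j < K.+1) iter j (fun y => 2%:R *: L y - y) y0 /\
   (let values : set R :=
      [set enorm (residual L (polyact Q L y0)) | Q in admissible K] in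
    values (1 / K.+1%:R) /\ lbound values (1 / K.+1%:R))) /\
  (* (iii) *)
  (forall k : nat, (k <= K)%N ->
     (forall Q : {poly R}, admissible k Q ->
        1 / Num.sqrt (K.+1%:R * k.+1%:R)
          <= enorm (residual L (polyact Q L y0))) /\
     [set Q : {poly R} | admissible k Q /\
        enorm (residual L (polyact Q L y0)) = 1 / Num.sqrt (K.+1%:R * k.+1%:R)]
       = [set fejer_zeta R k]).
Proof.
move=> L; have kn : (K < K.+1)%N by [].
(* The polynomial bounds of (i) and (ii) are the case [k = K] of those of (iii). *)
have sqK : Num.sqrt (K.+1%:R * K.+1%:R) = K.+1%:R :> R.
  by rewrite -expr2 sqrtr_sqr ger0_norm ?ler0n.
have lb (Q : {poly R}) : admissible K Q ->
    1 / K.+1%:R <= enorm (residual L (polyact Q L y0)).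
  by move=> /(enorm_residual_ge hy0 kn); rewrite sqK.
have minE := enorm_residual_minimizer hy0 kn; rewrite sqK in minE.
split; [split=> // m|split; [split=> //|]].
- have [Q adQ] := iterate_polyact (blockmap (fun j : 'I_K.+1 =>
    cos (half_phi R j) *: rotmx (half_phi R j))) m y0 K.
  by rewrite /= -resolvent_extremal -/L => ->; exact: lb.
- split; last first.
    split; last by move=> _ [Q /lb ? <-].
    have : [set fejer_zeta R K] (fejer_zeta R K) by [].
    by rewrite -minE => -[adF eqF]; exists (fejer_zeta R K).
  (* In the variable [u] the polynomial acts through [2L - I] and all its coefficients are
     [1 / (K + 1)]. *)
  rewrite polyact_resolvent fejer_zetaE to_zetaK fejerE.
  rewrite (polyact_wide _ _ (size_poly _ _)) scaler_sumr.
  apply: eq_bigr => j _; rewrite coef_poly ltn_ord div1r -two_resolvent_sub1.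
  by congr (_ *: iter j _ y0); apply/funext => v; rewrite scaleN1r.
- move=> k leK; split=> [Q|]; first exact: enorm_residual_ge.
  exact: enorm_residual_minimizer.
Qed.
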